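(* Let $G=(V,E)$ be a connected finite graph and let $0<\beta<1$. Then every complex zero $\lambda$ of the polynomial $\mathcal{D}Z_I(G,\beta,\lambda)=\lambda\frac{\partial}{\partial\lambda}Z_I(G,\beta,\lambda)$ (viewed as a polynomial in $\lambda$) satisfies $|\lambda|<1$. In particular $Z_I(G,\beta,\lambda)$ and $\mathcal{D}Z_I(G,\beta,\lambda)$ have no common zero, i.e. $Z_I(G,\beta,\cdot)$ has only simple zeros.
   Context: For a finite undirected graph $G=(V,E)$, $0<\beta\le 1$ and $\lambda\in\mathbb{C}$, the ferromagnetic Ising partition function is $Z_I(G,\beta,\lambda)=\sum_{\sigma\in\{+,-\}^V}\beta^{d(\sigma)}\lambda^{p(\sigma)}$, where $d(\sigma)$ is the number of edges $\{u,v\}\in E$ with $\sigma(u)\neq\sigma(v)$ and $p(\sigma)$ is the number of vertices $v$ with $\sigma(v)=+$. It is a polynomial in $\lambda$ of degree $|V|$. *)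

(* Defs.v *)
From HB Require Import structures.
From mathcomp Require Import all_boot all_order all_algebra.
Set Implicit Arguments. Unset Strict Implicit. Unset Printing Implicit Defensive.
Import Order.TTheory GRing.Theory Num.Theory.
Local Open Scope ring_scope.

Definition simple_graph (T : finType) (e : rel T) : Prop :=
  symmetric e /\ irreflexive e.

Definition graph_connected (T : finType) (e : rel T) : Prop :=
  forall x y : T, connect e x y.

Definition edges (T : finType) (e : rel T) : {set {set T}} :=
  [set [set x.1; x.2] | x in [set x : T * T | e x.1 x.2]].

(* spin configurations: sigma v = true means sigma(v) = + *)
Definition disagree (T : finType) (e : rel T) (s : {ffun T -> bool}) : nat :=
  #|[set f in edges e | [exists u in f, exists v in f, s u != s v]]|.

Definition nplus (T : finType) (s : {ffun T -> bool}) : nat :=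
  #|[set v | s v]|.

Definition ZI (C : numClosedFieldType) (T : finType) (e : rel T) (beta : C)
  : {poly C} :=
  \sum_(s : {ffun T -> bool}) (beta ^+ disagree e s) *: 'X^(nplus s).

Definition DZI (C : numClosedFieldType) (T : finType) (e : rel T) (beta : C)
  : {poly C} :=
  'X * (ZI e beta)^`().

(* Main.v *)
(* Give each vertex v its own variable z_v. Adding an edge {u, v} replaces
   a + b z_u + c z_v + d z_u z_v by a + t b z_u + t c z_v + d z_u z_v with t < 1,
   which preserves zero-freeness on the open bidisk and lets z_v reach the unit
   circle. Spreading along edges, a connected graph has Z != 0 as soon as all
   |z_w| <= 1 and one |z_w| < 1. For |lambda| >= 1 and mu = 1 / lambda, the spin
   flip gives DZ(lambda) = lambda^n sum_v A_v(mu), where A_v is the part of Z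
   with v in state -, and the A_v lie in a common open half-plane: the one around
   Z(mu) if Z(mu) != 0, and otherwise they are positive multiples of each
   other. *)
Require Import Defs.
From HB Require Import structures.
From mathcomp Require Import all_boot all_order all_algebra.
From mathcomp Require Import ring.
Import Order.TTheory GRing.Theory Num.Theory.
Local Open Scope ring_scope.

(** * Bilinear polynomials without zeros on the open bidisk *)

Section Bidisk.
Set Implicit Arguments. Unset Strict Implicit.
Variable C : numClosedFieldType.
Implicit Types a b c d x y t r p q : C.

Lemma normC_sqr_le x y : (`|x| <= `|y|) = (x * x^* <= y * y^*).
Proof. by rewrite -!normCK ler_pXn2r // nnegrE. Qed.

Lemma normC_sqr_lt x y : (`|x| < `|y|) = (x * x^* < y * y^*).
Proof. by rewrite -!normCK ltr_pXn2r // nnegrE. Qed.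

(** Otherwise the root [- (p / q)] would lie in the open disk. *)
Lemma le_norm_open p q : (forall x, `|x| < 1 -> p + q * x != 0) -> `|q| <= `|p|.
Proof.
move=> h; rewrite real_leNgt ?normr_real //; apply/negP => lt_pq.
have q0 : q != 0 by apply: contraTneq lt_pq => ->; rewrite normr0 normr_lt0.
have /h : `|- (p / q)| < 1.
  by rewrite normrN normf_div ltr_pdivrMr ?normr_gt0 // mul1r.
by rewrite mulrN mulrC divfK // subrr eqxx.
Qed.

Lemma lt_norm_closed p q : (forall x, `|x| <= 1 -> p + q * x != 0) -> `|q| < `|p|.
Proof.
move=> h; rewrite real_ltNge ?normr_real //; apply/negP => le_pq.
have q0 : q != 0.
  apply: contraTneq le_pq => q0; move: (h 0); rewrite normr0 ler01 mulr0 addr0.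
  by move=> /(_ isT) p0; rewrite q0 normr0 normr_le0.
have /h : `|- (p / q)| <= 1.
  by rewrite normrN normf_div ler_pdivrMr ?normr_gt0 // mul1r.
by rewrite mulrN mulrC divfK // subrr eqxx.
Qed.

Definition bidisk_free a b c d :=
  forall x y, `|x| < 1 -> `|y| < 1 -> a + b * x + c * y + d * x * y != 0.

Lemma bidisk_freeC a b c d : bidisk_free a b c d -> bidisk_free a c b d.
Proof.
move=> h x y hx hy; suff -> : a + c * x + b * y + d * x * y =
  a + b * y + c * x + d * y * x by apply: h.
by ring.
Qed.

(** For [|x| < 1] this is [le_norm_open] in the variable [y]. The boundary case follows by
    continuity, made explicit by contracting [x] to [r * x]. *)
Lemma bidisk_free_le a b c d x : bidisk_free a b c d -> `|x| <= 1 ->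
  `|c + d * x| <= `|a + b * x|.
Proof.
move=> h hx.
have open r : `|r| < 1 -> `|c + d * r| <= `|a + b * r|.
  move=> hr; apply: le_norm_open => y hy.
  suff -> : a + b * r + (c + d * r) * y = a + b * r + c * y + d * r * y by apply: h.
  by ring.
rewrite real_leNgt ?normr_real //; apply/negP => gap.
pose del := `|c + d * x| - `|a + b * x|; pose M := `|b| + `|d|.
have del0 : 0 < del by rewrite subr_gt0.
have M0 : 0 <= M by rewrite addr_ge0.
have dM : 0 < del + M by rewrite ltr_pwDl.
(* With this choice [(1 - r) * (del + M) = del], so passing from [x] to [r * x] costs at most
   [(1 - r) * M < del] in total, and the gap survives at an interior point. *)
pose r := M / (del + M).
have r0 : 0 <= r by rewrite divr_ge0 // ltW.
have r1 : r < 1 by rewrite ltr_pdivrMr // mul1r ltrDr.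
have rx : `|r * x| < 1.
  by rewrite normrM ger0_norm //; apply: le_lt_trans r1; rewrite ler_piMr.
have := open _ rx; apply/negP; rewrite -real_ltNge ?normr_real //.
have s0 : 0 <= 1 - r by rewrite subr_ge0 ltW.
have mv p : `|p * ((1 - r) * x)| <= (1 - r) * `|p|.
  rewrite !normrM (ger0_norm s0) mulrCA ler_wpM2l // ler_piMr //.
have small : (1 - r) * M < del.
  have -> : (1 - r) * M = del * r by rewrite /r; field; rewrite gt_eqF.
  by rewrite gtr_pMr.
have up : `|a + b * (r * x)| <= `|a + b * x| + (1 - r) * `|b|.
  have -> : a + b * (r * x) = a + b * x - b * ((1 - r) * x) by ring.
  by apply: le_trans (ler_normB _ _) _; rewrite lerD2l.
have down : `|c + d * x| - (1 - r) * `|d| <= `|c + d * (r * x)|.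
  rewrite lerBlDr; have -> : c + d * x = c + d * (r * x) + d * ((1 - r) * x) by ring.
  by apply: le_trans (ler_normD _ _) _; rewrite lerD2l.
apply: le_lt_trans up _; apply: lt_le_trans down.
by rewrite ltrBrDr -addrA -mulrDr -ltrBrDl.
Qed.

(* The operator [b, c |-> t b, t c] preserves bidisk-freeness and gains a
   boundary circle.  When [|x| <= t] one evaluates the closed inequality
   [|c + d x| <= |a + b x|] at [x / t]; otherwise at [x / |x|], combined with
   its average over [1] and [- 1]. *)
Lemma bidisk_free_damp a b c d t x y : bidisk_free a b c d ->
  0 < t -> t < 1 -> `|x| < 1 -> `|y| <= 1 ->
  a + t * b * x + t * c * y + d * x * y != 0.
Proof.
move=> h t0 t1 hx hy.
have hC := bidisk_freeC h.
have a0 : a != 0.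
  have := h 0 0; rewrite normr0 ltr01 => /(_ isT isT).
  by rewrite !mulr0 !addr0.
have ba : `|b| <= `|a|.
  have := bidisk_free_le hC (x := 0); rewrite normr0 ler01 => /(_ isT).
  by rewrite !mulr0 !addr0.
have tr : t^* = t by apply: conj_Creal; rewrite ger0_real // ltW.
have t2 : 0 < 1 - t ^+ 2 by rewrite subr_gt0 expr_lt1 // ltW.
have A0 : 0 < a * a^* by rewrite mul_conjC_gt0.
have BA : 0 <= a * a^* - b * b^* by rewrite subr_ge0 -normC_sqr_le.
set r := `|x|.
have r0 : 0 <= r by rewrite normr_ge0.
have xx : x * x^* = r ^+ 2 by rewrite -normCK.
have r2 : 0 < 1 - r ^+ 2 by rewrite subr_gt0 expr_lt1.
(* The polynomial is affine in [y], so a strict comparison of its two coefficients excludes zeros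
   with [|y| <= 1]. *)
suff key : `|t * c + d * x| < `|a + t * b * x|.
  apply: contraTneq key => e0.
  have -> : a + t * b * x = - ((t * c + d * x) * y).
    by apply/eqP; rewrite -subr_eq0 opprK -e0; apply/eqP; ring.
  by rewrite -real_leNgt ?normr_real // normrN normrM ler_piMr.
have AtB : 0 < a * a^* - t ^+ 2 * (b * b^*).
  have -> : a * a^* - t ^+ 2 * (b * b^*) =
    (1 - t ^+ 2) * (a * a^*) + t ^+ 2 * (a * a^* - b * b^*) by ring.
  apply: ltr_pwDl; first by apply: mulr_gt0.
  by apply: mulr_ge0; rewrite // exprn_ge0 // ltW.
rewrite normC_sqr_lt !(rmorphD, rmorphM) /= tr -subr_gt0.
have [rt|tr'] := real_leP (normr_real x) (gtr0_real t0).
  have xt : `|x / t| <= 1 by rewrite normf_div (gtr0_norm t0) ler_pdivrMr // mul1r.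
  have := bidisk_free_le h xt.
  rewrite normC_sqr_le !(rmorphD, rmorphM) /= fmorphV /= tr -subr_ge0.
  set D := (X in 0 <= X) => D0.
  have -> : (a + t * b * x) * (a^* + t * b^* * x^*) -
     (t * c + d * x) * (t * c^* + d^* * x^*) =
     t ^+ 2 * D + (1 - t ^+ 2) * (a * a^* - r ^+ 2 * (b * b^*)).
    by rewrite -xx /D; field; rewrite gt_eqF.
  apply: ltr_wpDl; first by apply: mulr_ge0; rewrite // exprn_ge0 // ltW.
  apply: mulr_gt0 => //.
  have -> : a * a^* - r ^+ 2 * (b * b^*) =
    (1 - r ^+ 2) * (a * a^*) + r ^+ 2 * (a * a^* - b * b^*) by ring.
  apply: ltr_pwDl; first by apply: mulr_gt0.
  by apply: mulr_ge0; rewrite // exprn_ge0.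
have rp : 0 < r by apply: lt_trans tr'.
have rr : r^* = r by apply: conj_Creal; rewrite ger0_real.
have xr : `|x / r| <= 1 by rewrite normf_div (gtr0_norm rp) divff ?gt_eqF.
have := bidisk_free_le h xr.
rewrite normC_sqr_le !(rmorphD, rmorphM) /= fmorphV /= rr -subr_ge0.
set H := (X in 0 <= X) => H0.
have avg (a' b' c' d' : C) : bidisk_free a' b' c' d' ->
    0 <= a' * a'^* + b' * b'^* - c' * c'^* - d' * d'^*.
  move=> h'.
  have n1 : `|1 : C| <= 1 by rewrite normr1.
  have nm1 : `|-1 : C| <= 1 by rewrite normrN1.
  have := bidisk_free_le h' n1; have := bidisk_free_le h' nm1.
  rewrite !normC_sqr_le !(rmorphD, rmorphM, rmorphN1, rmorph1) /= -subr_ge0 => e1.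
  rewrite -subr_ge0 => e2; have e3 := addr_ge0 e1 e2.
  rewrite -(pmulr_rge0 _ (ltr0Sn C 1)); congr (0 <= _): e3; ring.
have P1 := avg _ _ _ _ h; have P2 := avg _ _ _ _ hC.
pose A := a * a^*; pose B := b * b^*; pose G := c * c^*; pose D := d * d^*.
set E := (X in 0 < X).
(* The multiple [t * r * H] carries all cross terms of [E]; the remainder involves only the squared
   norms [A], [B], [G], [D]. *)
have EH : E = t * r * H + ((1 - t * r) * (A - t * r * B) + (t - r) * (r * D - t * G)).
  rewrite /E /H /A /B /G /D.
  have r0' : r != 0 by rewrite gt_eqF.
  have -> : x^* = r ^+ 2 / x.
    by rewrite -xx mulrAC divff ?mul1r // -normr_gt0.
  by field; rewrite r0' -normr_gt0.
rewrite EH; apply: ltr_wpDl; first by rewrite mulr_ge0 // mulr_ge0 // ltW.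
have main0 : 0 < (1 - r ^+ 2) * (A - t ^+ 2 * B) by apply: mulr_gt0.
have rt0 : 0 <= r - t by rewrite subr_ge0 ltW.
(* Once the positive term [main0] is split off, [P1] leaves a nonnegative multiple of [G - B] and
   [P2] one of [B - G]; the case split picks the favourable sign. *)
have [BG|GB] := real_leP (ger0_real (mul_conjC_ge0 b)) (ger0_real (mul_conjC_ge0 c)).
  have -> : (1 - t * r) * (A - t * r * B) + (t - r) * (r * D - t * G) =
     (1 - r ^+ 2) * (A - t ^+ 2 * B) + ((r + t) * (r - t) * (G - B) +
       (r - t) * r * (A + B - G - D)) by ring.
  apply: ltr_pwDl => //; apply: addr_ge0; apply: mulr_ge0; rewrite ?subr_ge0 //.
  - by rewrite mulr_ge0 // addr_ge0 // ltW.
  - by rewrite mulr_ge0.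
  - by rewrite -subr_ge0; exact: P1.
have -> : (1 - t * r) * (A - t * r * B) + (t - r) * (r * D - t * G) =
     (1 - r ^+ 2) * (A - t ^+ 2 * B) + ((r - t) * (r - t) * (B - G) +
       (r - t) * r * (A + G - B - D)) by ring.
apply: ltr_pwDl => //; apply: addr_ge0; apply: mulr_ge0; rewrite ?subr_ge0 //.
- by rewrite mulr_ge0.
- by rewrite ltW.
- by rewrite mulr_ge0.
- by rewrite -subr_ge0; exact: P2.
Qed.

End Bidisk.

(** * The multivariate partition function and its zero-free region *)

Section LeeYang.
Set Implicit Arguments. Unset Strict Implicit.
Variables (C : numClosedFieldType) (T : finType) (beta : C).
Hypotheses (beta0 : 0 < beta) (beta1 : beta < 1).
Implicit Types (F : {set {set T}}) (s : {ffun T -> bool}) (z : T -> C).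
Implicit Types (P : pred {ffun T -> bool}).

Definition cut s (f : {set T}) := [exists u in f, exists v in f, s u != s v].

Definition weight F s : C := beta ^+ #|[set f in F | cut s f]|.

(** [F] is an arbitrary edge set, so that edges can be deleted one at a time; [P] fixes some spins,
    which selects coefficients of the full sum in the variables of those vertices. *)
Definition Zsum F P z : C :=
  \sum_(s | P s) weight F s * \prod_v z v ^+ s v.

Lemma cut_pair s u v : cut s [set u; v] = (s u != s v).
Proof.
apply/idP/idP => [/exists_inP[a ha /exists_inP[b hb]]|ne].
  move: ha hb; rewrite !inE => /orP[]/eqP-> /orP[]/eqP->; rewrite ?eqxx //.
  by rewrite eq_sym.
apply/exists_inP; exists u; first by rewrite !inE eqxx.
by apply/exists_inP; exists v; rewrite // !inE eqxx orbT.
Qed.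

Lemma weight_rem F s u v : [set u; v] \in F ->
  weight F s = beta ^+ (s u != s v) * weight (F :\ [set u; v]) s.
Proof.
move=> Ff; rewrite /weight -exprD; congr (_ ^+ _).
rewrite (cardsD1 [set u; v]) inE Ff cut_pair; congr (_ + _)%N.
by apply: eq_card => f; rewrite !inE andbA.
Qed.

Lemma Zsum_scale1 F z z' v x :
  (forall w, z' w = z w * (if w == v then x else 1)) ->
  Zsum F xpredT z' = Zsum F (fun s => ~~ s v) z + Zsum F (fun s => s v) z * x.
Proof.
move=> hz; rewrite /Zsum (bigID (fun s => s v)) /= addrC mulr_suml.
have hp s : \prod_w z' w ^+ s w = (\prod_w z w ^+ s w) * x ^+ s v.
  transitivity (\prod_w (z w ^+ s w * (if w == v then x ^+ s v else 1))).
    apply: eq_bigr => w _; rewrite hz exprMn; congr (_ * _).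
    by case: eqP => [->|] //; rewrite expr1n.
  by rewrite big_split /= -big_mkcond big_pred1_eq.
congr (_ + _); apply: eq_bigr => s; rewrite hp.
  by move=> /negbTE->; rewrite mulr1.
by move=> ->; rewrite mulrA.
Qed.

(** The sum is affine in each variable. Using multipliers relative to [z] serves two purposes: with
    [z] equal to 1 at [u] and [v] they are the variables themselves, and with [z] constant the
    coefficients are parts of the univariate sum. *)
Lemma Zsum_scale2 F z z' u v x y : u != v ->
  (forall w, z' w = z w * (if w == u then x else if w == v then y else 1)) ->
  Zsum F xpredT z' = Zsum F (fun s => ~~ s u && ~~ s v) z
    + Zsum F (fun s => s u && ~~ s v) z * x
    + Zsum F (fun s => ~~ s u && s v) z * y
    + Zsum F (fun s => s u && s v) z * x * y.
Proof.
move=> uv hz; rewrite /Zsum (bigID (fun s => s u)) /=.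
rewrite (bigID (fun s => s v)) [X in _ + X](bigID (fun s => s v)) /=.
have hp s : \prod_w z' w ^+ s w = (\prod_w z w ^+ s w) * (x ^+ s u * y ^+ s v).
  transitivity (\prod_w (z w ^+ s w * ((if w == u then x ^+ s u else 1) *
      (if w == v then y ^+ s v else 1)))).
    apply: eq_bigr => w _; rewrite hz exprMn; congr (_ * _).
    case: (eqVneq w u) => [->|_]; first by rewrite (negbTE uv) mulr1.
    by case: eqP => [->|] //; rewrite mul1r // expr1n.
  by rewrite !big_split /= -!big_mkcond !big_pred1_eq.
have E (Q : pred {ffun T -> bool}) b1 b2 :
    (forall s, Q s -> s u = b1 /\ s v = b2) ->
  \sum_(s | Q s) weight F s * \prod_w z' w ^+ s w =
  (\sum_(s | Q s) weight F s * \prod_w z w ^+ s w) * (x ^+ b1 * y ^+ b2).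
  by move=> hQ; rewrite mulr_suml; apply: eq_bigr => s /hQ[<- <-]; rewrite hp mulrA.
rewrite (E (fun s => s u && s v) true true) => [|s /andP[-> ->] //].
rewrite (E (fun s => s u && ~~ s v) true false) => [|s /andP[-> /negbTE->] //].
rewrite (E (fun s => ~~ s u && s v) false true) => [|s /andP[/negbTE-> ->] //].
rewrite (E (fun s => ~~ s u && ~~ s v) false false); last first.
  by move=> s /andP[/negbTE-> /negbTE->].
by rewrite !expr0 !expr1; ring.
Qed.

Lemma Zsum_rem F P u v b : [set u; v] \in F ->
  (forall s, P s -> (s u != s v) = b) ->
  Zsum F P =1 fun z => beta ^+ b * Zsum (F :\ [set u; v]) P z.
Proof.
move=> Ff hP z; rewrite /Zsum mulr_sumr; apply: eq_bigr => s /hP hb.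
by rewrite (weight_rem _ Ff) hb mulrA.
Qed.

Lemma Zsum_set0 z : Zsum set0 xpredT z = \prod_v (1 + z v).
Proof.
transitivity (\prod_v \sum_(b : bool) z v ^+ b); last first.
  by apply: eq_bigr => v _; rewrite big_bool addrC.
rewrite bigA_distr_bigA; apply: eq_bigr => s _.
rewrite /weight (_ : [set f in set0 | _] = set0) ?cards0 ?mul1r //.
by apply/setP => f; rewrite !inE.
Qed.

(** The second hypothesis says that every connected component meets [U]. By induction on the number
    of edges: delete an edge from [u] in [U] to [v], apply the induction hypothesis with [v] added
    to [U], and restore the edge by [bidisk_free_damp], which lets the variable at [v] return to the
    closed disk. *)
Lemma lee_yang F (U : {set T}) z :
  (forall f, f \in F -> exists u v, u != v /\ f = [set u; v]) ->
  (forall A : {set T}, U \subset A -> A != setT ->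
     exists u v, [/\ u \in A, v \notin A & [set u; v] \in F]) ->
  (forall w, w \in U -> `|z w| < 1) -> (forall w, `|z w| <= 1) ->
  Zsum F xpredT z != 0.
Proof.
move En: #|F| => n; elim: n F U z En => [|n IH] F U z En hF hU zU z1.
  have F0 : F = set0 by apply/eqP; rewrite -cards_eq0 En.
  have UT : U = setT.
    apply/eqP/negPn/negP => /(hU _ (subxx _))[u [v [_ _]]].
    by rewrite F0 inE.
  rewrite F0 Zsum_set0; apply/prodf_neq0 => v _.
  have : `|z v| < 1 by apply: zU; rewrite UT inE.
  by apply: contraTneq => /eqP; rewrite addrC addr_eq0 => /eqP->; rewrite normrN1 ltxx.
have [u [v [uv Ff uU]]] : exists u v, [/\ u != v, [set u; v] \in F & u \in U].
  have [UT|nUT] := eqVneq U setT.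
    have /set0Pn[f Ff] : F != set0 by rewrite -cards_eq0 En.
    have [u [v [uv ef]]] := hF _ Ff.
    by exists u, v; rewrite UT inE -ef.
  have [u [v [uU vU Ff]]] := hU _ (subxx _) nUT.
  by exists u, v; split=> //; apply: contraNneq vU => <-.
(* Activity 1 at [u] and [v] turns the restricted sums into the coefficients of the bilinear
   polynomial in these two variables. *)
pose zz w := if w == u then 1 else if w == v then 1 else z w.
pose zxy x y w := zz w * (if w == u then x else if w == v then y else 1).
have free : bidisk_free (Zsum (F :\ [set u; v]) (fun s => ~~ s u && ~~ s v) zz)
   (Zsum (F :\ [set u; v]) (fun s => s u && ~~ s v) zz)
   (Zsum (F :\ [set u; v]) (fun s => ~~ s u && s v) zz)
   (Zsum (F :\ [set u; v]) (fun s => s u && s v) zz).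
  move=> x y hx hy; rewrite -(@Zsum_scale2 _ zz (zxy x y)) //.
  apply: (IH _ (v |: U)).
  - by move: En; rewrite (cardsD1 [set u; v]) Ff => -[].
  - by move=> f; rewrite inE => /andP[_ /hF].
  (* An edge leaving [A] is not the deleted one, since [A] now contains both [u] and [v]. *)
  - move=> A; rewrite subUset sub1set => /andP[vA UA] /(hU _ UA)[u' [v' [uA' vA' Ff']]].
    exists u', v'; split=> //; rewrite !inE Ff' andbT.
    apply: contraNneq vA' => e; have : v' \in [set u; v] by rewrite -e !inE eqxx orbT.
    by rewrite !inE => /orP[]/eqP-> //; apply: (subsetP UA).
  - move=> w; rewrite /zxy /zz !inE.
    by case: ifP => _; rewrite ?mul1r //; case: ifP => _; rewrite ?mul1r ?mulr1 //= => /zU.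
  - move=> w; rewrite /zxy /zz.
    case: ifP => _; first by rewrite mul1r ltW.
    by case: ifP => _; rewrite ?mul1r ?mulr1 // ltW.
(* Restoring the edge multiplies exactly the two mixed-spin coefficients by [beta], which is the
   damping with [t = beta]. *)
have := bidisk_free_damp free beta0 beta1 (zU _ uU) (z1 v).
rewrite (@Zsum_scale2 _ zz z u v (z u) (z v)) //; last first.
  by move=> w; rewrite /zz; case: eqP => [->|_]; rewrite ?mul1r //;
     case: eqP => [->|_]; rewrite ?mul1r ?mulr1.
rewrite (@Zsum_rem _ _ _ _ false Ff) => [|s /andP[/negbTE-> /negbTE->] //].
rewrite (@Zsum_rem _ _ _ _ true Ff) => [|s /andP[-> /negbTE->] //].
rewrite (@Zsum_rem _ _ _ _ true Ff) => [|s /andP[/negbTE-> ->] //].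
rewrite (@Zsum_rem _ _ _ _ false Ff) => [|s /andP[-> ->] //].
by rewrite !expr0 !expr1 !mul1r.
Qed.

(** * Connected graphs: one vertex strictly inside the disk suffices *)

Section Connected.
Variable e : rel T.
Hypotheses (e_simple : simple_graph e) (e_conn : graph_connected e).
Let F := edges e.
Let S P (mu : C) := Zsum F P (fun _ => mu).
Let flip s : {ffun T -> bool} := [ffun v => ~~ s v].

Lemma edges_pair f : f \in edges e -> exists u v, u != v /\ f = [set u; v].
Proof.
case/imsetP => -[u v]; rewrite inE /= => euv ->; exists u, v; split=> //.
by apply: contraTneq euv => ->; rewrite e_simple.2.
Qed.

(** If no edge left [A], then [A] would be closed under adjacency and would contain everything
    reachable from [w]. *)
Lemma edges_crossing (A : {set T}) w : w \in A -> A != setT ->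
  exists u v, [/\ u \in A, v \notin A & [set u; v] \in edges e].
Proof.
move=> wA nAT.
have [/exists_inP[u uA /exists_inP[v vA euv]]|] :=
    boolP [exists u in A, exists v in ~: A, e u v].
  exists u, v; split=> //; first by rewrite inE in vA.
  by apply/imsetP; exists (u, v); rewrite // inE.
rewrite negb_exists_in => /forall_inP no; case/negP: nAT; apply/eqP/setP => y.
rewrite inE -(closed_connect _ (e_conn w y)) //.
have out x x' : e x x' -> x \in A -> x' \in A.
  move=> exx' xA; have := no _ xA; rewrite negb_exists_in => /forall_inP no'.
  by apply/negPn/negP => x'A; have := no' x'; rewrite inE x'A exx' => /(_ isT).
by move=> x x' exx'; apply/idP/idP; apply: out; rewrite // e_simple.1.
Qed.

Lemma lee_yang_connected z v : `|z v| < 1 -> (forall w, `|z w| <= 1) ->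
  Zsum F xpredT z != 0.
Proof.
move=> zv z1; apply: (@lee_yang _ [set v]) => //; first exact: edges_pair.
  by move=> A; rewrite sub1set => vA; apply: edges_crossing vA.
by move=> w /set1P->.
Qed.

(** * Equal activities: comparing the parts of the sum with prescribed spins *)

Lemma Zsum_diagE P mu : S P mu = \sum_(s | P s) beta ^+ disagree e s * mu ^+ nplus s.
Proof.
apply: eq_bigr => s _; congr (_ * _); rewrite prodrXr /nplus -sum1_card.
by rewrite [in RHS]big_mkcond; congr (_ ^+ _); apply: eq_bigr => v _; rewrite inE; case: (s v).
Qed.

Lemma Zsum_diag_le mu v : `|mu| <= 1 ->
  `|S (fun s => s v) mu| <= `|S (fun s => ~~ s v) mu|.
Proof.
move=> mu1; apply: le_norm_open => x hx.
rewrite -(@Zsum_scale1 F _ (fun w => mu * (if w == v then x else 1))) //.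
apply: (@lee_yang_connected _ v) => [|w]; rewrite ?eqxx normrM.
  by apply: le_lt_trans hx; rewrite ler_piMl.
by case: ifP => _; rewrite ?normr1 ?mulr1 // mulr_ile1 // ltW.
Qed.

(** Activity 0 at [v] forces the state - there and already provides the vertex strictly inside the
    disk. The multiplier at [u] may then range over the closed disk, whence strictness. *)
Lemma Zsum_diag_lt mu u v : `|mu| <= 1 -> u != v ->
  `|S (fun s => s u && ~~ s v) mu| < `|S (fun s => ~~ s u && ~~ s v) mu|.
Proof.
move=> mu1 uv; apply: lt_norm_closed => x hx.
have := @Zsum_scale2 F (fun _ => mu) _ u v x 0 uv (fun w => erefl).
rewrite !mulr0 !addr0 => <-.
apply: (@lee_yang_connected _ v) => [|w].
  by rewrite eq_sym (negbTE uv) eqxx mulr0 normr0.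
rewrite normrM; case: ifP => _; first by rewrite mulr_ile1.
by case: ifP => _; rewrite ?normr0 ?mulr0 // normr1 mulr1.
Qed.

(** The global spin flip keeps the disagreeing edges and exchanges plus and minus vertices. *)
Lemma Zsum_diag_flip P mu : mu != 0 ->
  S P mu = mu ^+ #|T| * S (fun s => P (flip s)) mu^-1.
Proof.
move=> mu0; rewrite !Zsum_diagE mulr_sumr.
have flipK : involutive flip.
  by move=> s; apply/ffunP => v; rewrite !ffunE negbK.
rewrite (reindex_inj (inv_inj flipK)); apply: eq_bigr => s _.
rewrite mulrCA; congr (_ * _).
  congr (_ ^+ _); apply: eq_card => f; rewrite !inE; congr (_ && _).
  apply: eq_existsb => a; congr (_ && _); apply: eq_existsb => b; congr (_ && _).
  by rewrite !ffunE (inj_eq negb_inj).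
have -> : #|T| = (nplus (flip s) + nplus s)%N.
  rewrite -(cardsC [set v | s v]) addnC; congr (_ + _)%N.
  by apply: eq_card => v; rewrite !inE ffunE.
by rewrite exprD -mulrA -exprMn divff // expr1n mulr1.
Qed.

Lemma Zsum_diagT v mu : S xpredT mu = S (fun s => s v) mu + S (fun s => ~~ s v) mu.
Proof. exact: bigID. Qed.

(** The weights are real, so on the unit circle conjugation amounts to evaluation at [mu^-1], which
    the spin flip undoes. *)
Lemma Zsum_diag_conj P mu : `|mu| = 1 ->
  (S P mu)^* * mu ^+ #|T| = S (fun s => P (flip s)) mu.
Proof.
move=> mu1; have mu0 : mu != 0 by rewrite -normr_eq0 mu1 oner_eq0.
have muc : mu^* = mu^-1 by rewrite invC_norm mu1 expr1n invr1 mul1r.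
rewrite [RHS]Zsum_diag_flip // mulrC; congr (_ * _).
rewrite !Zsum_diagE rmorph_sum /=; apply: eq_big => s.
  by congr P; apply/ffunP => v; rewrite !ffunE negbK.
by rewrite rmorphM !rmorphXn /= muc (conj_Creal (gtr0_real beta0)).
Qed.

Lemma Zsum_minus_neq0 mu v : `|mu| <= 1 -> S (fun s => ~~ s v) mu != 0.
Proof.
move=> mu1.
have -> : S (fun s => ~~ s v) mu = Zsum F xpredT (fun w => mu * (if w == v then 0 else 1)).
  by rewrite (@Zsum_scale1 F (fun _ => mu) _ v 0) // mulr0 addr0.
apply: (@lee_yang_connected _ v) => [|w].
  by rewrite eqxx mulr0 normr0.
by case: ifP => _; rewrite ?mulr0 ?normr0 ?mulr1.
Qed.

(* On the circle with [Z = 0], the symmetry under complex conjugation gives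
   [A_u * A_v^* = |a|^2 - |b|^2], where [a], [b] are the parts of [Z] with
   [(u, v)] in states [(-, -)] and [(+, -)]. *)
Lemma Zsum_minus_aligned mu u v : `|mu| = 1 -> S xpredT mu = 0 ->
  0 < S (fun s => ~~ s u) mu * (S (fun s => ~~ s v) mu)^*.
Proof.
move=> mu1 Z0; have mule : `|mu| <= 1 by rewrite mu1.
have [->|uv] := eqVneq u v; first by rewrite mul_conjC_gt0 Zsum_minus_neq0.
have := Zsum_diag_lt mule uv; rewrite normC_sqr_lt -subr_gt0.
set a := S (fun s => ~~ s u && ~~ s v) mu; set b := S (fun s => s u && ~~ s v) mu.
pose c := S (fun s => ~~ s u && s v) mu; pose d := S (fun s => s u && s v) mu.
have ha : a^* * mu ^+ #|T| = d.
  rewrite /a Zsum_diag_conj //; apply: eq_bigl => s.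
  by rewrite !ffunE !negbK.
have hb : b^* * mu ^+ #|T| = c.
  by rewrite /b Zsum_diag_conj //; apply: eq_bigl => s; rewrite !ffunE negbK.
have Au : S (fun s => ~~ s u) mu = c + a by exact: (bigID (fun s => s v)).
have Av : S (fun s => ~~ s v) mu = b + a.
  rewrite /S /Zsum (bigID (fun s => s u)) /=.
  by congr (_ + _); apply: eq_bigl => s; rewrite andbC.
have Bv : S (fun s => s v) mu = d + c.
  rewrite /S /Zsum (bigID (fun s => s u)) /=.
  by congr (_ + _); apply: eq_bigl => s; rewrite andbC.
have sum0 : d + c = - (b + a).
  by apply/eqP; rewrite -addr_eq0 -Z0 (Zsum_diagT v) Av Bv.
rewrite Au Av rmorphD /=; congr (0 < _).
transitivity (b^* * (d + c) + a * (a^* + b^*)).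
  by rewrite sum0; ring.
by rewrite -ha -hb; ring.
Qed.

Lemma sum_Zsum_minus_neq0 mu : (0 < #|T|)%N -> `|mu| <= 1 ->
  \sum_v S (fun s => ~~ s v) mu != 0.
Proof.
move=> /card_gt0P[v0 _] mu1.
have [Z0|Z0] := eqVneq (S xpredT mu) 0.
  (* Inside the open disk the sum cannot vanish, so this zero lies on the circle. *)
  have mu_circ : `|mu| = 1.
    apply/eqP; move: mu1; rewrite le_eqVlt => /orP[//|mu_lt].
    have := @lee_yang_connected (fun _ => mu) v0 mu_lt (fun _ => ltW mu_lt).
    by rewrite -/(S xpredT mu) Z0 eqxx.
  suff : 0 < (\sum_v S (fun s => ~~ s v) mu) * (S (fun s => ~~ s v0) mu)^*.
    by apply: contraTneq => ->; rewrite mul0r ltxx.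
  rewrite mulr_suml (bigD1 v0) //= ltr_wpDr ?Zsum_minus_aligned // sumr_ge0 // => v _.
  by rewrite ltW ?Zsum_minus_aligned.
(* [|B_v| <= |A_v|] means that [A_v / Z] has real part at least [1/2]. *)
have half v : `|S xpredT mu| ^+ 2 <=
    S (fun s => ~~ s v) mu * (S xpredT mu)^* + (S (fun s => ~~ s v) mu)^* * S xpredT mu.
  have := Zsum_diag_le v mu1; rewrite normC_sqr_le -subr_ge0 normCK (Zsum_diagT v).
  by rewrite rmorphD /= => h; rewrite -subr_ge0; congr (0 <= _): h; ring.
have : 0 < \sum_(v : T) `|S xpredT mu| ^+ 2.
  rewrite (bigD1 v0) //= ltr_wpDr ?exprn_gt0 ?normr_gt0 // sumr_ge0 // => v _.
  by rewrite exprn_ge0.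
(* Summed over [v], the right-hand side of [half] depends only on the total of the minus parts and
   would vanish with it. *)
move=> /lt_le_trans/(_ (ler_sum _ (fun v _ => half v))).
rewrite big_split /= -!mulr_suml -rmorph_sum; apply: contraTneq => ->.
by rewrite rmorph0 !mul0r addr0 ltxx.
Qed.

(** * Back to the polynomials [ZI] and [DZI] *)

Lemma horner_ZI lam : (ZI e beta).[lam] = S xpredT lam.
Proof.
rewrite Zsum_diagE /ZI horner_sum; apply: eq_bigr => s _.
by rewrite hornerZ hornerXn.
Qed.

(** The operator multiplies each term by its number of plus vertices; exchanging sums counts these
    vertex by vertex. *)
Lemma horner_DZI lam : (DZI e beta).[lam] = \sum_v S (fun s => s v) lam.
Proof.
rewrite /DZI /ZI raddf_sum mulr_sumr horner_sum.
under [RHS]eq_bigr => v _ do rewrite Zsum_diagE big_mkcond.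
rewrite exchange_big /=; apply: eq_bigr => s _.
rewrite -big_mkcond sumr_const derivZ derivXn -scalerAr hornerZ.
rewrite hornerM hornerX hornerMn hornerXn -mulrnAr; congr (_ * _).
rewrite mulrnAr -exprS.
have -> : #|[pred v | s v]| = nplus s by apply: eq_card => v; rewrite !inE.
(* The exponent [n.-1.+1] differs from [n] only at [n = 0], where the multiplicity is 0. *)
by case: (nplus s).
Qed.

Lemma root_DZI_lt1 lam : (0 < #|T|)%N -> root (DZI e beta) lam -> `|lam| < 1.
Proof.
move=> T0; rewrite rootE horner_DZI; apply: contraLR.
rewrite -real_leNgt ?normr_real ?real1 // => lam1.
have lam0 : lam != 0 by rewrite -normr_gt0 (lt_le_trans ltr01).
under eq_bigr => v _ do rewrite Zsum_diag_flip //.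
rewrite -mulr_sumr mulf_neq0 ?expf_neq0 //.
have lamV : `|lam^-1| <= 1 by rewrite normfV invf_le1 // normr_gt0.
under eq_bigr => v _.
  rewrite (_ : S _ _ = S (fun s => ~~ s v) lam^-1); first over.
  by apply: eq_bigl => s; rewrite ffunE.
exact: sum_Zsum_minus_neq0.
Qed.

Lemma root_ZI_ge1 lam : (0 < #|T|)%N -> root (ZI e beta) lam -> 1 <= `|lam|.
Proof.
move=> /card_gt0P[v0 _]; apply: contraLR.
rewrite -real_ltNge ?normr_real ?real1 // => lam1; rewrite rootE horner_ZI.
by apply: (@lee_yang_connected _ v0) => // w; apply: ltW.
Qed.

End Connected.
End LeeYang.

Theorem theorem1 (C : numClosedFieldType) (T : finType) (e : rel T) (beta : C) :
  simple_graph e -> graph_connected e -> (0 < #|T|)%N ->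
  0 < beta -> beta < 1 ->
  (forall lam : C, root (DZI e beta) lam -> `|lam| < 1) /\
  (forall lam : C, root (ZI e beta) lam -> ~~ root (DZI e beta) lam) /\
  (forall lam : C, root (ZI e beta) lam -> ~~ root (ZI e beta)^`() lam).
Proof.
move=> e_simple e_conn T0 beta0 beta1.
have D1 lam : root (DZI e beta) lam -> `|lam| < 1 by exact: root_DZI_lt1.
have ZD lam : root (ZI e beta) lam -> ~~ root (DZI e beta) lam.
  move=> /(root_ZI_ge1 beta0 beta1 e_simple e_conn T0) lam1.
  by apply/negP => /D1; rewrite (le_gtF lam1).
split=> //; split=> // lam /ZD; apply: contraNN.
by rewrite /DZI rootM orbC => ->.
Qed.
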